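(* Let $X$ and $Y$ be infinite compact spaces and let $Z$ be a metrizable space containing a homeomorphic copy of $\mathbb R$. Then a compact space $K$ embeds homeomorphically into $S(X\times Y,Z)$ if and only if $w(K)<\min\{c^\sharp(X),c^\sharp(Y)\}$.
   Context: All compact spaces are assumed Hausdorff. For topological spaces $X,Y,Z$, a function $f:X\times Y\to Z$ is separately continuous if $y\mapsto f(x,y)$ is continuous for every $x\in X$ and $x\mapsto f(x,y)$ is continuous for every $y\in Y$. $S(X\times Y,Z)$ denotes the set of all separately continuous functions $X\times Y\to Z$. For $p=(a,b)\in X\times Y$, the cross of $p$ is $\mathrm{cr}\{p\}=(\{a\}\times Y)\cup(X\times\{b\})$. For $X,Y$ compact and $Z$ metrizable with a compatible metric $d$, $S(X\times Y,Z)$ carries the topology generated by the family of extended pseudometrics $d_c(s,t)=\sup_{p\in\mathrm{cr}\{c\}} d(s(p),t(p))$, $c\in X\times Y$ (the cross-uniform topology); it coincides with the cross-open topology, generated by the subbase of sets $\{s: s(A)\subseteq W\}$ with $W$ open in $Z$ and $A=\overline{G}\cap C$, where $C=\mathrm{cr}\{p\}$ for some $p$ and $G$ is open in $C$. $w(K)$ is the weight of $K$. The sharp cellularity is $c^\sharp(X)=\sup\{|\mathcal U|^+:\mathcal U$ a family of pairwise disjoint open sets in $X\}$, where $\mathfrak m^+$ denotes the least cardinal greater than $\mathfrak m$. *)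

(* Defs.v *)
From HB Require Import structures.
From mathcomp Require Import all_boot all_order all_algebra.
From mathcomp Require Import all_classical all_reals all_analysis.
From mathcomp Require Import Rstruct Rstruct_topology.
Set Implicit Arguments. Unset Strict Implicit. Unset Printing Implicit Defensive.
Import Order.TTheory GRing.Theory Num.Theory.
Local Open Scope classical_set_scope.
Local Open Scope ring_scope.

Definition compact_space (T : topologicalType) :=
  compact [set: T] /\ hausdorff_space T.

Definition infinite_space (T : topologicalType) := ~ finite_set [set: T].

Definition metrizable (Z : topologicalType) :=
  exists d : Z -> Z -> Rdefinitions.R,
    [/\ (forall x y, 0 <= d x y),
        (forall x y, d x y = 0 <-> x = y),
        (forall x y, d x y = d y x),
        (forall x y z, d x z <= d x y + d y z) &
        (forall U : set Z, open U <->
           (forall x, U x -> exists2 e : Rdefinitions.R, 0 < e &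
                 [set y | d x y < e] `<=` U))].

Definition embedding (T U : topologicalType) (f : T -> U) :=
  [/\ injective f, continuous f &
      forall A : set T, open A ->
        exists2 B : set U, open B & f @` A = f @` [set: T] `&` B].

Definition contains_real_line (Z : topologicalType) :=
  exists g : Rdefinitions.R -> Z, embedding g.

Section Cross.
Variables (X Y Z : topologicalType).

Definition sep_cont (f : X * Y -> Z) :=
  (forall x : X, continuous (fun y : Y => f (x, y))) /\
  (forall y : Y, continuous (fun x : X => f (x, y))).

Definition S_XYZ : set (X * Y -> Z) := [set f | sep_cont f].

Definition cross (p : X * Y) : set (X * Y) :=
  [set q | q.1 = p.1 \/ q.2 = p.2].

Definition cross_adm (A : set (X * Y)) :=
  exists p : X * Y, exists G : set (X * Y),
    (exists2 G' : set (X * Y), open G' & G = G' `&` cross p) /\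
    A = closure G `&` cross p.

Definition cross_subbasic (A : set (X * Y)) (W : set Z) : set (X * Y -> Z) :=
  [set s | S_XYZ s /\ s @` A `<=` W].

Definition cross_subbasic_pair (AW : set (X * Y) * set Z) :=
  cross_adm AW.1 /\ open AW.2.

(* open sets of the cross-open topology on S(X*Y,Z): the topology
   generated by the subbase above (finite intersections = base; the empty
   intersection is the whole space S). *)
Definition cross_open (O : set (X * Y -> Z)) :=
  O `<=` S_XYZ /\
  forall s, O s -> exists l : seq (set (X * Y) * set Z),
    [/\ all (fun AW => `[< cross_subbasic_pair AW >]) l,
        (forall AW, AW \in l -> cross_subbasic AW.1 AW.2 s) &
        [set t | S_XYZ t /\ forall AW, AW \in l -> cross_subbasic AW.1 AW.2 t]
          `<=` O].

Definition embeds_into_S (K : topologicalType) :=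
  exists e : K -> (X * Y -> Z),
    [/\ (forall k, S_XYZ (e k)), injective e,
        (forall O, cross_open O -> open (e @^-1` O)) &
        (forall A : set K, open A ->
           exists2 O, cross_open O & e @` A = e @` [set: K] `&` O)].
End Cross.

Definition is_base (K : topologicalType) (B : set (set K)) :=
  (forall b, B b -> open b) /\
  (forall U : set K, open U -> forall x, U x ->
     exists b, [/\ B b, b x & b `<=` U]).

Definition cellular_family (T : topologicalType) (F : set (set T)) :=
  (forall U, F U -> open U /\ U !=set0) /\
  (forall U V, F U -> F V -> U <> V -> U `&` V = set0).

(* w(K) < c^#(X).  Since c^#(X) = sup { |U|^+ : U cellular }, this holds iff
   w(K) < |U|^+, i.e. w(K) <= |U|, for some cellular family U; and
   w(K) <= |U| iff some base of K has cardinality <= |U|. *)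
Definition weight_lt_csharp (K X : topologicalType) :=
  exists (U : set (set X)) (B : set (set K)),
    [/\ cellular_family U, is_base B & (B #<= U)%card].

(* Main.v *)
(** From right to left, pick disjoint families of nonempty open sets (U_i) in X
and (V_i) in Y, both indexed by pairs of basic open sets of K, with bumps phi_i
on U_i and psi_i on V_i, and functions f_i on K separating points from closed
sets.  Then [k |-> sum_i f_i(k) phi_i(x) psi_i(y)], composed with a copy of the
line in Z, embeds K: each cross meets at most two of the supports.

From left to right, compactness of K makes [F(x,y) = (k |-> e(k)(x,y))] a
separately continuous map into C(K,Z).  By Namioka's argument the open subsets
of X on which all F(.,y) oscillate by less than 1/n form a pi-base; a maximal
disjoint family M_n of them yields a set of card(M_n) * aleph_0 points which is
1/n-dense for F.  So w(K) <= sup_n card(M_n) * aleph_0.  By the Erdos-Tarski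
argument for countable cofinality this supremum is attained by one disjoint
family. *)
Require Import Defs.
From mathcomp Require Import all_boot all_order all_algebra.
From mathcomp Require Import all_classical all_reals all_analysis.
From mathcomp Require Import Rstruct Rstruct_topology lra.
Set Implicit Arguments. Unset Strict Implicit. Unset Printing Implicit Defensive.
Import Order.TTheory GRing.Theory Num.Theory numFieldNormedType.Exports.
Local Open Scope classical_set_scope.

(** * Comparison of cardinalities *)

(** Cardinals are represented by types: products, sums and subtypes then give their arithmetic. *)
Definition inj_le (A B : Type) := exists f : A -> B, injective f.

Lemma inj_le_refl A : inj_le A A.
Proof. by exists id. Qed.

Lemma inj_le_trans B A C : inj_le A B -> inj_le B C -> inj_le A C.
Proof. by move=> [f fi] [g gi]; exists (g \o f); exact: inj_comp. Qed.

Lemma inj_le_prod A B C D : inj_le A B -> inj_le C D -> inj_le (A * C) (B * D).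
Proof.
move=> [f fi] [g gi]; exists (fun p => (f p.1, g p.2)).
by move=> [a c] [a' c'] /= [/fi-> /gi->].
Qed.

(** A maximal graph of a partial injection, given by Zorn's lemma, is total on one side: otherwise a
    point of [A] and a point of [B] that it misses form a pair that can be added. *)
Lemma inj_le_total A B : inj_le A B \/ inj_le B A.
Proof.
pose P (G : set (A * B)) := forall p q, G p -> G q -> (p.1 = q.1 <-> p.2 = q.2).
have [F FP Ftot|G [PG Gmax]] := @Zorn_bigcup _ P.
  move=> p q [G FG Gp] [H FH Hq].
  by have [GH|HG] := Ftot _ _ FG FH; [apply: (FP _ FH) => //; exact: GH|
    apply: (FP _ FG) => //; exact: HG].
have [/choice[f fG]|nA] := pselect (forall a, exists b, G (a, b)).
  left; exists f => a a' e.
  by have [_ /(_ e)] := PG _ _ (fG a) (fG a').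
have [/choice[f fG]|nB] := pselect (forall b, exists a, G (a, b)).
  right; exists f => b b' e.
  by have [/(_ e)] := PG _ _ (fG b) (fG b').
move: nA => /existsNP[a /forallNP na]; move: nB => /existsNP[b /forallNP nb].
case: (Gmax (G `|` [set (a, b)])).
  split; first by move=> p; left.
  by move=> /(_ (a, b)) h; apply: (na b); apply: h; right.
move=> [p1 p2] [q1 q2] [Gp|->] [Gq|->] /=; last by [].
- exact: (PG _ _ Gp Gq).
- by split=> e; [case: (na p2); rewrite -e|case: (nb p1); rewrite -e].
- by split=> e; [case: (na q2); rewrite e|case: (nb q1); rewrite e].
Qed.

Lemma inj_le_sum A : inj_le nat A -> inj_le (A * A) A -> inj_le (A + A) A.
Proof.
move=> [i ii] hA; apply: inj_le_trans hA.
exists (fun s => match s with inl a => (i 0, a) | inr a => (i 1, a) end).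
by move=> [a|a] [b|b] [] // => [->|/ii|/ii|->].
Qed.

(* Apply Zorn's lemma to the graphs of injections A * A -> A with A containing
the image of i.  For a maximal one, A does not embed into its complement, since
otherwise the injection extends to the union of A and its copy; so the
complement embeds into A and T into A + A, hence into A. *)
Section square.
Variables (T : Type) (i : nat -> T).
Hypothesis i_inj : injective i.

(** A graph carries its own domain, which is read off the diagonal. *)
Let dom (G : set ((T * T) * T)) : set T := [set a | exists c, G ((a, a), c)].
(** These are the graphs of injections of the square of [dom G] into [dom G]; the equivalence
    expresses single-valuedness and injectivity together. *)
Let sq (G : set ((T * T) * T)) :=
  [/\ forall p q, G p -> G q -> (p.1 = q.1 <-> p.2 = q.2),
      forall a b c, G ((a, b), c) -> [/\ dom G a, dom G b & dom G c] &
      forall a b, dom G a -> dom G b -> exists c, G ((a, b), c)].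
Let G0 : set ((T * T) * T) :=
  range (fun p : nat * nat => ((i p.1, i p.2), i (pickle p))).

Let dom_sub G H a : G `<=` H -> dom G a -> dom H a.
Proof. by move=> GH [c /GH Hc]; exists c. Qed.

Let sqG0 : sq G0.
Proof.
have dG0 n : dom G0 (i n) by exists (i (pickle (n, n))); exists (n, n).
split.
- move=> _ _ [[m n] _ <-] [[k l] _ <-] /=; split => [[]/i_inj-> /i_inj->//|].
  by move=> /i_inj /(pcan_inj pickleK) [-> ->].
- by move=> a b c [[m n] _ [<- <- <-]]; split; exact: dG0.
- move=> a b [c [[m m'] _ [<- _ _]]] [c' [[n n'] _ [<- _ _]]].
  by exists (i (pickle (m, n))); exists (m, n).
Qed.

Let sq_max : exists G, [/\ G0 `<=` G, sq G & forall H, G `<` H -> ~ sq H].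
Proof.
(* The union of the empty chain is [set0], so [Q] has to admit it; it is not maximal, since [G0]
   extends it. *)
pose Q G := G = set0 \/ (G0 `<=` G /\ sq G).
have [F FQ Ftot|G [QG Gmax]] := @Zorn_bigcup _ Q.
  have [[G1 [FG1 [x G1x]]]|nF] := pselect (exists G, F G /\ G !=set0); last first.
    left; apply/seteqP; split => // x [G FG Gx].
    by apply: nF; exists G; split => //; exists x.
  have FS G x' : F G -> G x' -> sq G.
    by move=> FG Gx'; case: (FQ _ FG) => [G_0|[]//]; move: Gx'; rewrite G_0.
  have sub G : F G -> G `<=` \bigcup_(X in F) X by move=> FG y Gy; exists G.
  right; split.
    case: (FQ _ FG1) => [G_0|[+ _]]; first by move: G1x; rewrite G_0.
    by move=> /subset_trans; apply; exact: sub.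
  split.
  - move=> p q [G FG Gp] [H FH Hq].
    have [GH|HG] := Ftot _ _ FG FH.
    + by have [h _ _] := FS _ _ FH Hq; apply: h => //; exact: GH.
    + by have [h _ _] := FS _ _ FG Gp; apply: h => //; exact: HG.
  - move=> a b c [G FG Gp]; have [_ /(_ _ _ _ Gp)[da db dc] _] := FS _ _ FG Gp.
    by split; apply: (dom_sub (sub _ FG)).
  - move=> a b [c [G FG Gp]] [d [H FH Hq]].
    have [GH|HG] := Ftot _ _ FG FH.
    + have [_ _ h] := FS _ _ FH Hq; have [||e He] := h a b.
      * by exists c; exact: GH.
      * by exists d.
      * by exists e; exists H.
    + have [_ _ h] := FS _ _ FG Gp; have [||e He] := h a b.
      * by exists c.
      * by exists d; exact: HG.
      * by exists e; exists G.
case: QG => [G_0|[G0G sG]].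
  exfalso; apply: (Gmax G0); last by right; split.
  have x0 : G0 ((i 0, i 0), i (pickle (0, 0))) by exists (0, 0).
  by rewrite G_0; split => // h; case: (h _ x0).
by exists G; split => // H GH sH; apply: (Gmax H GH); right; split => //;
  apply: subset_trans G0G _; exact: GH.1.
Qed.

Lemma inj_le_square : inj_le (T * T) T.
Proof.
have [G [G0G sG Gmax]] := sq_max; have [G1 G2 G3] := sG.
pose A := {a | dom G a}; pose C := {a | ~ dom G a}.
have svi (P : T -> Prop) : injective (@sval T P).
  by move=> [a pa] [b pb] /= e; exact: eq_exist.
have natA : inj_le nat A.
  have h n : dom G (i n).
    by apply: (dom_sub G0G); exists (i (pickle (n, n))); exists (n, n).
  by exists (fun n => exist _ (i n) (h n)) => m n [] /i_inj.
have AA : inj_le (A * A) A.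
  have /choice[f fG] : forall p : A * A, exists c : A, G ((sval p.1, sval p.2), sval c).
    move=> [a b]; have [c Gc] := G3 _ _ (svalP a) (svalP b).
    by have [_ _ dc] := G2 _ _ _ Gc; exists (exist _ c dc).
  exists f => -[a b] [a' b'] e.
  have [_ /=] := G1 _ _ (fG (a, b)) (fG (a', b')).
  by rewrite e => /(_ erefl) [/svi-> /svi->].
have sumA := inj_le_sum natA AA.
have [[j ji]|CA] := inj_le_total A C; last first.
  have TA : inj_le T A.
    apply: inj_le_trans sumA; move: CA => [h hi].
    have /choice[f fP] : forall t, exists s : A + A,
        match s with inl a => sval a = t | inr a => exists2 c, h c = a & sval c = t end.
      move=> t; have [d|nd] := pselect (dom G t); first by exists (inl (exist _ t d)).
      by exists (inr (h (exist _ t nd))); exists (exist _ t nd).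
    exists f => t t' e; move: (fP t) (fP t'); rewrite e.
    case: (f t') => a => [<-//|[c h1 <-] [c' h2 <-]].
    by congr sval; apply: hi; rewrite h1.
  by apply: inj_le_trans (inj_le_prod TA TA) _; apply: inj_le_trans AA _; exists sval; exact: svi.
pose u (s : A + A) := match s with inl a => sval a | inr a => sval (j a) end.
have ui : injective u.
  move=> [a|a] [b|b] /= e; first by rewrite (svi _ _ _ e).
  - by case: (svalP (j b)); rewrite -e; exact: svalP.
  - by case: (svalP (j a)); rewrite e; exact: svalP.
  - by rewrite (ji _ _ (svi _ _ _ e)).
have [code codei] : inj_le ((A + A) * (A + A)) A.
  exact: inj_le_trans (inj_le_prod sumA sumA) AA.
(* Pairs with a coordinate in the image of [j] get their values in this image, so neither arguments
   nor values clash with those of [G]. *)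
pose new (p : (A + A) * (A + A)) :=
  match p with (inl _, inl _) => False | _ => True end.
pose N : set ((T * T) * T) :=
  [set ((u p.1, u p.2), sval (j (code p))) | p in new].
have newN p : N p -> ~ (dom G p.1.1 /\ dom G p.1.2) /\ ~ dom G p.2.
  move=> [[[a|a] [b|b]] // _ <-] /=; split; try exact: (svalP (j _));
   by move=> [h1 h2]; first [exact: (svalP (j a))|exact: (svalP (j b))].
have GN p : G p -> [/\ dom G p.1.1, dom G p.1.2 & dom G p.2].
  by case: p => [[a b] c] /G2.
have domu s : dom (G `|` N) (u s).
  case: s => a; first by have [c Gc] := svalP a; exists c; left.
  by exists (sval (j (code (inr a, inr a)))); right; exists (inr a, inr a).
have udom t : dom (G `|` N) t -> exists s, u s = t.
  move=> [c [Gc|[[s s'] _ [<- _ _]]]]; last by exists s.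
  by have [d _ _] := G2 _ _ _ Gc; exists (inl (exist _ t d)).
have [a0] : inhabited A by case: natA => f _; exists; exact: (f 0).
exfalso; apply: (Gmax (G `|` N)).
  split; first by move=> p; left.
  have Nx : N ((u (inr a0), u (inr a0)), sval (j (code (inr a0, inr a0)))).
    by exists (inr a0, inr a0).
  move=> /(_ _ (or_intror Nx)) /GN [_ _ d].
  by have [_ +] := newN _ Nx; apply.
split.
- move=> p q [Gp|Np] [Gq|Nq].
  + exact: G1.
  + have [p1 p2 p3] := GN _ Gp; have [q1 q2] := newN _ Nq.
    by split=> e; [case: q1; rewrite -e|case: q2; rewrite -e].
  + have [p1 p2 p3] := GN _ Gq; have [q1 q2] := newN _ Np.
    by split=> e; [case: q1; rewrite e|case: q2; rewrite e].
  + move: Np Nq => [[p1 p2] _ <-] [[q1 q2] _ <-] /=; split.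
      by move=> [/ui-> /ui->].
    by move=> /svi /ji /codei [-> ->].
- move=> a b c [Gp|[[p q] _ [<- <- <-]]].
    have [[a' da] [b' db] [c' dc]] := G2 _ _ _ Gp.
    by split; [exists a'|exists b'|exists c']; left.
  by split; [exact: domu|exact: domu|exact: (domu (inr _))].
- move=> a b /udom[s <-] /udom[t <-].
  have [st|nst] := pselect (new (s, t)).
    by exists (sval (j (code (s, t)))); right; exists (s, t).
  case: s t nst => [s|s] [t|t] //= _.
  by have [c Gc] := G3 _ _ (svalP s) (svalP t); exists c; left.
Qed.
End square.

(** Folding the pairing over a list determines the list once its length is known, so the length is
    coded along with it. *)
Lemma inj_le_seq T : inj_le nat T -> inj_le (seq T) T.
Proof.
move=> [i ii]; have [p pinj] := inj_le_square ii.
pose c (s : seq T) := foldr (fun x y => p (x, y)) (i 0) s.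
exists (fun s => p (i (size s), c s)) => s t /pinj [] /ii.
elim: s t => [|x s IH] [|y t] //= [] es /pinj [-> e]; congr cons.
exact: IH.
Qed.

(** * Cellular families *)

(** As the members are nonempty, the last clause also makes [f] injective: [V] contains a cellular
    family of cardinality exactly that of [I]. *)
Definition cell (X : topologicalType) (I : Type) (V : set X) :=
  exists f : I -> set X,
    [/\ forall i, open (f i) /\ f i !=set0, forall i, f i `<=` V &
        forall i j x, f i x -> f j x -> i = j].

Lemma cell_inj (X : topologicalType) I J (V : set X) :
  inj_le I J -> cell J V -> cell I V.
Proof.
move=> [h hi] [f [f1 f2 f3]]; exists (f \o h); split => //=.
by move=> i j x fi fj; apply/hi/(f3 _ _ x).
Qed.

Lemma max_disjoint (X : topologicalType) (Q : set X -> Prop) :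
  exists M : set (set X),
    [/\ forall U, M U -> [/\ open U, U !=set0 & Q U],
        forall U V x, M U -> M V -> U x -> V x -> U = V &
        forall U, open U -> U !=set0 -> Q U -> exists2 V, M V & U `&` V !=set0].
Proof.
pose P (M : set (set X)) :=
  (forall U, M U -> [/\ open U, U !=set0 & Q U]) /\
  (forall U V x, M U -> M V -> U x -> V x -> U = V).
have [F FP Ftot|M [[M1 M2] Mmax]] := @Zorn_bigcup _ P.
  split=> [U [G FG]|U V x [G FG GU] [H FH HV]]; first exact: (FP _ FG).1.
  have [GH|HG] := Ftot _ _ FG FH.
  - by apply: (FP _ FH).2 => //; exact: GH.
  - by apply: (FP _ FG).2 => //; exact: HG.
exists M; split => // U oU U0 QU; apply: contrapT => nM.
have dis V x : M V -> U x -> V x -> False.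
  by move=> MV Ux Vx; apply: nM; exists V => //; exists x.
have nMU : ~ M U by move=> MU; have [x Ux] := U0; exact: (dis U x).
apply: (Mmax (M `|` [set U])).
  by split=> [V|/(_ U)]; [left|move=> h; apply/nMU/h; right].
split=> [V [/M1//|->//]|V W x [MV|->] [MW|->] //].
- exact: M2.
- by move=> Vx Ux; case: (dis V x).
- by move=> Ux Wx; case: (dis W x).
Qed.

(** An infinite open set [V] splits into a nonempty open piece and a disjoint infinite open
    remainder, and this is iterated. For disjoint open [A] and [B] meeting [V], the part of [V] in
    [A] is the piece if it is finite, and the remainder otherwise. *)
Lemma infinite_cell (X : topologicalType) :
  hausdorff_space X -> infinite_space X -> cell nat [set: X].
Proof.
move=> hX infX.
pose good (V : set X) := open V /\ infinite_set V.
have /choice[F FP] : forall V : set X, exists p : set X * set X,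
    good V -> [/\ open p.1, p.1 !=set0, good p.2, p.1 `<=` V /\ p.2 `<=` V &
      p.1 `&` p.2 = set0].
  move=> V; have [[oV iV]|] := pselect (good V); last by exists (V, V).
  have [x [y [Vx Vy xy]]] : exists x y, [/\ V x, V y & x <> y].
    have [x Vx] := infinite_setN0 iV.
    have [y [Vy xy]] : exists y, V y /\ x <> y.
      apply: contrapT => n; apply: iV; apply: (@sub_finite_set _ _ [set x]) => //.
      by move=> y Vy; apply: contrapT => yx; apply: n; exists y; split => // /esym.
    by exists x, y.
  have := hX; rewrite open_hausdorff => /(_ x y) [|[A B] /= [+ +] [oA oB AB]].
    exact/eqP.
  rewrite !inE => Ax By.
  have [fA|iA] := pselect (finite_set (V `&` A)).
    exists (V `&` A, V `\` A) => _ /=; split => //.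
    - exact: openI.
    - by exists x.
    - split; last first.
        move=> h; apply: iV; apply: (@sub_finite_set _ _ ((V `&` A) `|` (V `\` A))).
          by move=> z Vz; have [Az|nAz] := pselect (A z); [left|right].
        by rewrite finite_setU.
      (* [A] need not be closed, but its finite intersection with [V] is. *)
      have -> : V `\` A = V `&` ~` (V `&` A).
        apply/seteqP; split => [z [Vz nA]|z [Vz nA]]; first by split => // -[_ /nA].
        by split => // Az; apply: nA.
      apply: openI => //; apply: closed_openC.
      exact: (accessible_finite_set_closed.1 (hausdorff_accessible hX)).
    - by apply/seteqP; split => // z [[_ Az] [_ nA]].
  exists (V `&` B, V `&` A) => _ /=; split => //.
  - exact: openI.
  - by exists y.
  - by split => //; exact: openI.
  - by apply/seteqP; split => // z [[_ Bz] [_ Az]]; rewrite -(eqP AB).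
pose W n := iter n (fun V => (F V).2) setT.
have gW n : good (W n).
  elim: n => [|n IH] /=; first by split => //; exact: openT.
  by have [] := FP _ IH.
have WS m n : W (m + n)%N `<=` W n.
  elim: m => [//|m IH] z; rewrite addSn /= => h; apply: IH.
  by have [_ _ _ [_ +] _] := FP _ (gW (m + n)%N); apply.
have dis m n z : (m < n)%N -> (F (W m)).1 z -> (F (W n)).1 z -> False.
  move=> mn zm zn.
  have [_ _ _ [/(_ _ zn) zWn _] _] := FP _ (gW n).
  have zW : W m.+1 z by apply: (WS (n - m.+1)%N); rewrite subnK.
  have [_ _ _ _ /seteqP[/(_ z) + _]] := FP _ (gW m).
  by apply; split.
exists (fun n => (F (W n)).1); split => //.
- by move=> n; have [] := FP _ (gW n).
- move=> m n z zm zn; case: (ltngtP m n) => // mn.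
  + by case: (dis m n z).
  + by case: (dis n m z).
Qed.

Section erdos_tarski.
Variables (X : topologicalType) (I : nat -> Type).
Hypothesis cellI : forall n, cell (I n) [set: X].
Hypothesis infI : inj_le nat (I 0).
Hypothesis monI : forall n, inj_le (I n) (I n.+1).

Let mono m n : (m <= n)%N -> inj_le (I m) (I n).
Proof.
move=> /subnK <-; elim: (n - m)%N => [|k IH]; first exact: inj_le_refl.
exact: inj_le_trans IH (monI _).
Qed.

Let rich n (V : set X) := cell (I n) V.

Let rich_mono m n V : (m <= n)%N -> rich n V -> rich m V.
Proof. by move=> mn; apply: cell_inj; exact: mono. Qed.

(** Families chosen inside the disjoint sets [V n] unite to one family, indexed by the disjoint sum
    of the [I n]. *)
Let glue (V : nat -> set X) : (forall n, rich n (V n)) ->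
    (forall m n x, V m x -> V n x -> m = n) ->
  exists2 J : Type, cell J [set: X] & forall n, inj_le (I n) J.
Proof.
move=> rV Vd; pose f n := projT1 (cid (rV n)).
have fP n : [/\ forall i, open (f n i) /\ f n i !=set0,
    forall i, f n i `<=` V n & forall i j x, f n i x -> f n j x -> i = j].
  exact: projT2 (cid (rV n)).
exists {n & I n}.
  exists (fun p => f (projT1 p) (projT2 p)); split => //.
  - by move=> [n i] /=; have [] := fP n.
  - move=> [n i] [m j] x /= fi fj.
    have [_ /(_ _ _ fi) Vn _] := fP n; have [_ /(_ _ _ fj) Vm _] := fP m.
    have e := Vd _ _ _ Vn Vm; case: m / e j fj Vm => j fj _.
    by have [_ _ /(_ _ _ _ fi fj) ->] := fP n.
by move=> n; exists (existT _ n) => i j /(congr1 (tagged_as (existT I n i))); rewrite !tagged_asE.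
Qed.

(* Let M be a maximal disjoint family of open sets that fail to be n-rich for
some n.  If the union of M is not dense, an open set missing it contains
infinitely many disjoint sets that are n-rich for all n.  Otherwise either M
contains distinct sets v_k with v_k k-rich, or no member of M is n-rich for
some fixed n and then every I m embeds into M * I n. *)
Lemma erdos_tarski_mono :
  exists2 J : Type, cell J [set: X] & forall n, inj_le (I n) J.
Proof.
have [M [M1 M2 M3]] := max_disjoint (fun V : set X => exists n, ~ rich n V).
have [[V [oV [v Vv] VM]]|dense] := pselect (exists V : set X,
    [/\ open V, V !=set0 & forall U x, M U -> U x -> V x -> False]).
  have richV W : open W -> W !=set0 -> W `<=` V -> forall n, rich n W.
    move=> oW W0 WV n; apply: contrapT => nr.
    have [|U MU [x [Wx Ux]]] := M3 _ oW W0; first by exists n.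
    exact: (VM U x MU Ux (WV _ Wx)).
  have [||f [f1 f2 f3]] := cell_inj infI (richV V oV _ _ 0) => //; first by exists v.
  by apply: (@glue f) => // n; have [? ?] := f1 n; exact: richV.
have {}dense (W : set X) : open W -> W !=set0 -> exists2 U, M U & W `&` U !=set0.
  move=> oW W0; apply: contrapT => n; apply: dense; exists W; split => // U x MU Ux Wx.
  by apply: n; exists U => //; exists x.
have [/choice[v vP]|] := pselect (forall n, exists V, M V /\ rich n V).
  have /choice[N NP] : forall n, exists m, (n < m)%N /\ ~ rich m (v n).
    move=> n; have [_ _ [m nr]] := M1 _ (vP n).1; exists m; split => //.
    by rewrite ltnNge; apply/negP => /rich_mono /(_ (vP n).2).
  (* [v (s j)] is not rich at level [s j.+1], whereas [v (s k)] is for every k > j; hence these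
     members of [M] are distinct, and so disjoint. *)
  pose s k := iter k N 0.
  have s_mon j k : (s j <= s (j + k)%N)%N.
    elim: k => [|k IH]; first by rewrite addn0.
    by apply: (leq_trans IH); rewrite addnS /=; exact/ltnW/(NP _).1.
  have sk k : (k <= s k)%N.
    by elim: k => // k IH /=; exact: leq_ltn_trans IH (NP _).1.
  have dis j k x : (j < k)%N -> v (s j) x -> v (s k) x -> False.
    move=> jk vj vk; apply: (NP (s j)).2.
    rewrite (M2 _ _ _ (vP (s j)).1 (vP (s k)).1 vj vk).
    apply: rich_mono (vP (s k)).2.
    by rewrite -(subnKC jk); exact: (s_mon j.+1).
  apply: (@glue (v \o s)) => [n|m n x vm vn] /=.
    exact: rich_mono (sk n) (vP _).2.
  by case: (ltngtP m n) => // mn; [case: (dis m n x)|case: (dis n m x)].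
move=> /existsNP[n /forallNP nr].
pose TM := {U | M U}.
have cTM : cell TM [set: X].
  exists sval; split => //.
  - by move=> [U MU] /=; have [] := M1 _ MU.
  - by move=> [U MU] [V MV] x /= Ux Vx; apply: eq_exist; exact: (M2 _ _ x).
(* Each [f i] meets some member [p i] of [M]. The sets [f i] with [p i = U], cut down to [U], are
   disjoint in [U]; since [U] is not [n]-rich, there are at most as many of them as elements of
   [I n]. *)
have bound m : inj_le (I m) (TM * I n).
  have [f [f1 _ f3]] := cellI m.
  have /choice[p pP] : forall i, exists U : TM, f i `&` sval U !=set0.
    move=> i; have [U MU h] := dense (f i) (f1 i).1 (f1 i).2.
    by exists (exist _ U MU).
  have qex : forall U : TM, exists q : {i | p i = U} -> I n, injective q.
    move=> U; have [nI|//] := inj_le_total (I n) {i | p i = U}.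
    case: (nr (sval U)); split; first exact: svalP.
    apply: (cell_inj nI); exists (fun i => f (sval i) `&` sval U); split.
    - move=> [i pi] /=; split; last by rewrite -pi.
      by apply: openI; [exact: (f1 i).1|have [] := M1 _ (svalP U)].
    - by move=> i x [].
    - move=> [i pi] [j pj] x [/= fi _] [fj _]; apply: eq_exist; exact: (f3 _ _ x).
  pose q U := projT1 (cid (qex U)); have qP U : injective (q U) := projT2 (cid (qex U)).
  have key i j U V (ei : p i = U) (ej : p j = V) : U = V ->
      q U (exist _ i ei) = q V (exist _ j ej) -> i = j.
    by move=> UV; case: V / UV ej => ej /qP [].
  by exists (fun i => (p i, q (p i) (exist _ i erefl))) => i j [e1 e2]; exact: key e1 e2.
have [natn natni] := inj_le_trans infI (mono (leq0n n)).
(* The product embeds into the larger factor, which is infinite, and both factors index cellular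
   families. *)
have [le|le] := inj_le_total TM (I n).
  exists (I n) => // m; apply: (inj_le_trans (bound m)).
  by apply: (inj_le_trans (inj_le_prod le (inj_le_refl _))); exact: inj_le_square natni.
have [natT natTi] := inj_le_trans (inj_le_trans infI (mono (leq0n n))) le.
exists TM => // m; apply: (inj_le_trans (bound m)).
by apply: (inj_le_trans (inj_le_prod (inj_le_refl _) le)); exact: inj_le_square natTi.
Qed.
End erdos_tarski.

(** The running maxima of [nat] and the [I n] form an increasing sequence of infinite cardinals, to
    which the monotone case applies. *)
Lemma erdos_tarski (X : topologicalType) (I : nat -> Type) :
    cell nat [set: X] -> (forall n, cell (I n) [set: X]) ->
  exists J : Type,
    [/\ cell J [set: X], inj_le nat J & forall n, inj_le (I n) J].
Proof.
move=> cN cI.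
pose mx (A B : Type) := if pselect (inj_le B A) then A else B.
have mxP A B : [/\ inj_le A (mx A B), inj_le B (mx A B) &
    cell A [set: X] -> cell B [set: X] -> cell (mx A B) [set: X]].
  rewrite /mx; case: pselect => [h|h]; split => //; try exact: inj_le_refl.
  by case: (inj_le_total A B).
pose L := fix L (n : nat) : Type := match n with 0 => nat | S m => mx (L m) (I m) end.
have [n||n|J cJ JP] := @erdos_tarski_mono X L.
- by elim: n => //= n IH; have [_ _] := mxP (L n) (I n); apply.
- exact: inj_le_refl.
- by have [] := mxP (L n) (I n).
exists J; split => //; first exact: (JP 0).
by move=> n; apply: inj_le_trans (JP n.+1); have [] := mxP (L n) (I n).
Qed.

(** * Namioka's argument *)
Local Open Scope ring_scope.

Lemma compact_finite_cover (T : topologicalType) (A : set T) (V : T -> set T) :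
    compact A -> (forall x, A x -> nbhs x (V x)) ->
  exists s : seq T, forall y, A y -> exists x, [/\ x \in s, A x & V x y].
Proof.
move=> /compact_near_coveringP cA AV.
(* The near-covering property is used with finite lists, directed by inclusion, as parameters: on
   [V x], every list containing [x] serves. *)
pose F : set_system (seq T) :=
  filter_from setT (fun s : seq T => [set t : seq T | {subset s <= t}]).
have FF : Filter F.
  apply: filter_from_filter; first by exists [::].
  move=> s t _ _; exists (s ++ t) => // u /= h.
  by split=> x xs; apply: h; rewrite mem_cat xs // orbT.
have [|s _ /(_ s (fun x xs => xs)) h] :=
    cA _ F (fun s y => exists x, [/\ x \in s, A x & V x y]) FF.
  move=> x Ax; exists (V x, [set t : seq T | x \in t]).
    by split; [exact: AV|exists [:: x] => // t /(_ x); rewrite inE eqxx; exact].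
  by move=> [y t] /= [Vy xt]; exists x.
by exists s.
Qed.

Lemma near_seq (T : Type) (I : eqType) (F : set_system T) (P : I -> set T) (s : seq I) :
  Filter F -> (forall i, i \in s -> F (P i)) -> F [set x | forall i, i \in s -> P i x].
Proof.
move=> FF; elim: s => [|i s IH] h; first by apply: (filterS _ filterT).
have hi := h i (mem_head _ _).
have hs : F [set x | forall i, i \in s -> P i x].
  by apply: IH => j js; apply: h; rewrite inE js orbT.
apply: filterS (filterI hi hs) => x [xi xs] j.
by rewrite inE => /orP[/eqP->|/xs].
Qed.

Lemma regular_nbhs (X : topologicalType) (x : X) (V : set X) : compact_space X -> nbhs x V ->
  exists U, [/\ open U, U x & closure U `<=` V].
Proof.
move=> [cX hX] xV.
have [W xW WV] := compact_regular hX cX (@filterT _ _ (nbhs_filter x)) xV.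
exists W°; split; first exact: open_interior.
  exact: xW.
by apply: subset_trans WV; apply: closureS; exact: interior_subset.
Qed.

Definition is_metric (R : realType) (Z : Type) (d : Z -> Z -> R) :=
  [/\ forall x y, 0 <= d x y, forall x y, d x y = 0 <-> x = y,
      forall x y, d x y = d y x & forall x y z, d x z <= d x y + d y z].

(* F stands for a separately continuous map from X * Y to the space C(K, Z) with
the uniform metric, whence the quantifications over k inside the neighborhoods. *)
Section namioka.
Variables (R : realType) (X Y : topologicalType) (K Z : Type) (d : Z -> Z -> R).
Variable F : X -> Y -> K -> Z.
Hypotheses (cX : compact_space X) (cY : compact_space Y) (dm : is_metric d).
Hypothesis Fx : forall x y (e : R), 0 < e ->
  \forall x' \near x, forall k, d (F x y k) (F x' y k) < e.
Hypothesis Fy : forall x y (e : R), 0 < e ->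
  \forall y' \near y, forall k, d (F x y k) (F x y' k) < e.

Definition small_osc (e : R) (U : set X) :=
  forall x x' y k, U x -> U x' -> d (F x y k) (F x' y k) < e.

(** Suppose there are no such points. Finitely many [y_j] approximate every [y] within [dl] on [s],
    so [F x y] stays within [e] of some [F x y_j] for all [x] in [U]. Near a point of [U] the
    finitely many [F x y_j] vary by less than [e] from their values there, and four steps of size
    [e] bound the oscillation. *)
Let step (e : R) (U : set X) (s : seq X) (dl : R) : 0 < e -> 0 < dl -> open U -> U !=set0 ->
    (forall V, open V -> V !=set0 -> V `<=` U -> ~ small_osc (4 * e) V) ->
  exists y y' k x, [/\ U x, e < d (F x y k) (F x y' k) &
    forall a k', a \in s -> d (F a y k') (F a y' k') < dl].
Proof.
have [d0 dE dC dT] := dm.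
move=> e0 dl0 oU [x0 Ux0] nU; apply: contrapT => H.
pose W y0 := [set y | forall a, a \in s -> forall k, d (F a y0 k) (F a y k) < dl].
have nW y0 : nbhs y0 (W y0) by apply: near_seq => a _; exact: Fy.
have [t tP] := compact_finite_cover cY.1 (fun y _ => nW y).
pose V := U `&` [set x | forall y, y \in t -> forall k, d (F x0 y k) (F x y k) < e].
have nV : nbhs x0 V.
  apply: filterI; first by apply: open_nbhs_nbhs.
  by apply: near_seq => y _; exact: Fx.
apply: (nU V°).
- exact: open_interior.
- by exists x0.
- by move=> x /interior_subset [].
move=> x x' y k /interior_subset[Ux Vx] /interior_subset[Ux' Vx'].
have [yj [yjt _ Wy]] := tP y I.
have small z : U z -> d (F z yj k) (F z y k) <= e.
  move=> Uz; rewrite leNgt; apply/negP => he; apply: H.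
  by exists yj, y, k, z; split => // a k' /Wy.
have := small _ Ux; have := small _ Ux'; have := Vx _ yjt k; have := Vx' _ yjt k.
have := dT (F x y k) (F x yj k) (F x' y k).
have := dT (F x yj k) (F x0 yj k) (F x' y k).
have := dT (F x0 yj k) (F x' yj k) (F x' y k).
rewrite (dC (F x y k) (F x yj k)) (dC (F x yj k) (F x0 yj k)).
lra.
Qed.

(* If not, build decreasing V_n with points x_n and y_n, y'_n, k_n such that
F x_m y_n and F x_m y'_n get close for each m while F x y_n k_n and F x y'_n k_n
stay apart for x in V_n.  Clustering at a, y, y', one gets F a y = F a y', which
contradicts the continuity of F a at y and y'. *)
Lemma namioka (e : R) (O : set X) : 0 < e -> open O -> O !=set0 ->
  exists U, [/\ open U, U !=set0, U `<=` O & small_osc e U].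
Proof.
have [d0 dE dC dT] := dm.
move=> e0 oO O0; apply: contrapT => nO.
have {}nO V : open V -> V !=set0 -> V `<=` O -> ~ small_osc e V.
  by move=> ? ? ? ?; apply: nO; exists V.
pose e4 := e / 4.
have e40 : 0 < e4 by rewrite /e4; lra.
pose good (U : set X) := [/\ open U, U !=set0 & U `<=` O].
have /choice[G GP] : forall p : nat * set X * seq X, exists q : Y * Y * K * X * set X,
    good p.1.2 -> let: (y, y', k, x, V) := q in
    [/\ good V, V x, closure V `<=` p.1.2,
        forall x', V x' -> e4 < d (F x' y k) (F x' y' k) &
        forall a k', a \in p.2 -> d (F a y k') (F a y' k') < p.1.1.+1%:R^-1].
  move=> [[n U] s] /=; have [[oU U0 UO]|ng] := pselect (good U); last first.
    have [x _] := O0.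
    (* [G] needs a value on bad input too; the failure of small oscillation on [O] supplies points
       of [Y] and [K]. *)
    have [y [x' [k _]]] : exists y x' k, ~ d (F x' y k) (F x' y k) < 0 .
      have := nO O oO O0 (@subset_refl _ _) => /existsNP[a /existsNP[b /existsNP[y]]].
      by move=> /existsNP[k _]; exists y, a, k; rewrite (dE _ _).2 // ltxx.
    by exists (y, y, k, x, U).
  have [||y [y' [k [x [Ux xe sd]]]]] := @step e4 U s n.+1%:R^-1 e40 _ oU U0.
  - by rewrite invr_gt0 ltr0n.
  - move=> V oV V0 VU; have -> : 4 * e4 = e by rewrite /e4; lra.
    by apply: nO => //; exact: subset_trans VU UO.
  pose c := d (F x y k) (F x y' k) - e4.
  have c0 : 0 < c by rewrite /c; lra.
  have nV : nbhs x (U `&` [set x' | e4 < d (F x' y k) (F x' y' k)]).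
    apply: filterI; first exact: open_nbhs_nbhs.
    have c20 : 0 < c / 2 by lra.
    near=> x' => /=.
    have h1 : forall k, d (F x y k) (F x' y k) < c / 2 by near: x'; exact: Fx.
    have h2 : forall k, d (F x y' k) (F x' y' k) < c / 2 by near: x'; exact: Fx.
    have := dT (F x y k) (F x' y k) (F x y' k).
    have := dT (F x' y k) (F x' y' k) (F x y' k).
    by move: (h1 k) (h2 k); rewrite (dC (F x y' k)) /c; lra.
  have [V [oV Vx clV]] := regular_nbhs cX nV.
  have VU : V `<=` U by move=> z /subset_closure /clV [].
  exists (y, y', k, x, V) => _; split => //.
  - by split => //; [exists x|exact: subset_trans VU UO].
  - by move=> z /clV [].
  - by move=> z /subset_closure /clV [].
(* The state holds the current open set and the list of the points [x_ m] with m < n; [y_ n] and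
   [y'_ n] are chosen close at all of these. *)
pose st := fix st n : set X * seq X := match n with
  | 0%N => (O, [::])
  | m.+1 => let: (_, x, V) := G (m, (st m).1, (st m).2) in (V, x :: (st m).2) end.
pose q n := G (n, (st n).1, (st n).2).
pose y_ n := (q n).1.1.1.1; pose y'_ n := (q n).1.1.1.2.
pose k_ n := (q n).1.1.2; pose x_ n := (q n).1.2; pose V_ n := (st n).1.
have VS n : V_ n.+1 = (q n).2 by rewrite /V_ /= /q; case: (G _) => [[]].
have sS n : (st n.+1).2 = x_ n :: (st n).2 by rewrite /= /x_ /q; case: (G _) => [[]].
have goodV n : good (V_ n).
  elim: n => [|n IH]; first by split.
  by rewrite VS; move: (GP (n, (st n).1, (st n).2) IH); rewrite /q; case: (G _) => [[[[? ?] ?] ?] ?] [].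
have stepP n : [/\ V_ n.+1 (x_ n), closure (V_ n.+1) `<=` V_ n,
    forall x, V_ n.+1 x -> e4 < d (F x (y_ n) (k_ n)) (F x (y'_ n) (k_ n)) &
    forall a k, a \in (st n).2 -> d (F a (y_ n) k) (F a (y'_ n) k) < n.+1%:R^-1].
  rewrite VS /y_ /y'_ /k_ /x_; move: (GP (n, (st n).1, (st n).2) (goodV n)).
  by rewrite -/(q n); case: (q n) => [[[[? ?] ?] ?] ?] [].
have Vle m n : (m <= n)%N -> V_ n `<=` V_ m.
  move=> /subnK <-; elim: (n - m)%N => [//|j IH] z; rewrite addSn => Vz.
  by apply: IH; have [_ + _ _] := stepP (j + m)%N; apply; exact: subset_closure.
have xst m n : (m < n)%N -> x_ m \in (st n).2.
  elim: n => // n IH; rewrite ltnS sS inE leq_eqVlt => /orP[/eqP->|/IH->].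
    by rewrite eqxx.
  by rewrite orbT.
have [a [_ aP]] := cX.1 (x_ @ \oo) _ (@filterT _ _ _).
have aV n : V_ n a.
  have [_ + _ _] := stepP n; apply => B aB.
  have [|_ [[m /= mn <-] Bx]] := aP [set x_ m | m in [set m | (n <= m)%N]] B _ aB.
    by exists n => // m /= nm; exists m.
  exists (x_ m); split => //; have [Vx _ _ _] := stepP m.
  exact: (Vle n.+1 m.+1).
(* Clustering the pairs, not each sequence by itself, lets [y_ n] and [y'_ n] approach [y] and [y']
   at common indices. *)
have [] := @compact_setX Y Y setT setT cY.1 cY.1 ((fun n => (y_ n, y'_ n)) @ \oo) _.
  by apply: filterE => n; split.
move=> [y y'] [_ yP].
have yn (A B : set Y) m : nbhs y A -> nbhs y' B ->
    exists n, [/\ (m <= n)%N, A (y_ n) & B (y'_ n)].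
  move=> yA yB.
  have [||[z z'] [[n /= mn [<- <-]] [Az Bz]]] :=
      yP [set (y_ n, y'_ n) | n in [set n | (m <= n)%N]] (A `*` B).
  - by exists m => // n /= nm; exists n.
  - by exists (A, B).
  - by exists n.
have dle u v : (forall eta : R, 0 < eta -> d u v <= eta) -> u = v.
  move=> h; apply/dE/eqP; rewrite eq_le d0 andbT; apply/ler_addgt0Pr => eta eta0.
  by rewrite add0r; exact: h.
have xy m k : F (x_ m) y k = F (x_ m) y' k.
  apply: dle => eta eta0.
  have eta3 : 0 < eta / 3 by lra.
  have [N _ NP] : \forall n \near \oo, n.+1%:R^-1 < eta / 3 by exact: near_infty_natSinv_lt (PosNum eta3).
  have [n [mn h1 h2]] := yn _ _ (maxn m.+1 N) (Fy (x_ m) y eta3) (Fy (x_ m) y' eta3).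
  have [_ _ _ /(_ (x_ m) k) h3] := stepP n.
  have {}h3 := h3 (xst m n (leq_trans (leq_maxl _ _) mn)).
  have h4 : n.+1%:R^-1 < eta / 3 := NP n (leq_trans (leq_maxr _ _) mn).
  have := dT (F (x_ m) y k) (F (x_ m) (y_ n) k) (F (x_ m) y' k).
  have := dT (F (x_ m) (y_ n) k) (F (x_ m) (y'_ n) k) (F (x_ m) y' k).
  move: (h1 k) (h2 k) (lt_trans h3 h4); rewrite /= (dC (F (x_ m) y' k)); lra.
have ay k : F a y k = F a y' k.
  apply: dle => eta eta0.
  have eta2 : 0 < eta / 2 by lra.
  have [|_ [[m _ <-] [h1 h2]]] := aP (range x_) _ _ (filterI (Fx a y eta2) (Fx a y' eta2)).
    by exists 0%N => // n _; exists n.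
  have := dT (F a y k) (F (x_ m) y k) (F a y' k).
  by move: (h1 k) (h2 k); rewrite xy (dC (F a y' k)); lra.
have e8 : 0 < e4 / 2 by lra.
have [n [_ h1 h2]] := yn _ _ 0%N (Fy a y e8) (Fy a y' e8).
have [_ _ /(_ a (aV _)) + _] := stepP n.
have := dT (F a (y_ n) (k_ n)) (F a y (k_ n)) (F a (y'_ n) (k_ n)).
move: (h1 (k_ n)) (h2 (k_ n)); rewrite ay (dC (F a y' _)) (dC _ (F a y' _)).
rewrite (dC (F a y' _)); lra.
Unshelve. all: by end_near. Qed.
End namioka.

(** * The weight of a space of parameters *)

Lemma card_le_range A B (f : A -> B) : injective f -> ([set: A] #<= range f)%card.
Proof.
move=> fi; have := @inj_card_eq _ _ setT f (fun x y _ _ => @fi x y).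
by move=> /card_eqPle [].
Qed.

Lemma inj_le_card A B : inj_le A B -> ([set: A] #<= [set: B])%card.
Proof.
by move=> [f /card_le_range h]; apply: card_le_trans h _; exact: subset_card_le.
Qed.

Lemma weight_lt_csharp_indexed (X K : topologicalType) (J T : Type) (b : T -> set K) :
  cell J [set: X] -> inj_le T J -> is_base (range b) -> weight_lt_csharp K X.
Proof.
move=> [f [f1 _ f3]] TJ hb; exists (range f), (range b); split => //.
  split=> [_ [j _ <-]//|_ _ [i _ <-] [j _ <-] fij].
  by apply/seteqP; split => // x [fi fj]; apply: fij; rewrite (f3 _ _ _ fi fj).
apply: card_le_trans (card_image_le _ _) _; apply: card_le_trans (inj_le_card TJ) _.
apply: card_le_range => i j e.
by have [_ [x fx]] := f1 i; apply: (f3 _ _ x) => //; rewrite -e.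
Qed.

Section weight.
Variables (R : realType) (X Y K : topologicalType) (Z : Type) (d : Z -> Z -> R).
Variable F : X -> Y -> K -> Z.
Hypotheses (cX : compact_space X) (cY : compact_space Y) (cK : compact_space K).
Hypotheses (iX : infinite_space X) (dm : is_metric d).
Hypothesis Fx : forall x y (e : R), 0 < e ->
  \forall x' \near x, forall k, d (F x y k) (F x' y k) < e.
Hypothesis Fy : forall x y (e : R), 0 < e ->
  \forall y' \near y, forall k, d (F x y k) (F x y' k) < e.
Hypothesis Fk : forall x y k (e : R), 0 < e ->
  \forall k' \near k, d (F x y k) (F x y k') < e.
Hypothesis F_inj : forall k k', (forall x y, F x y k = F x y k') -> k = k'.

(** An index in [T] selects a member of [M n], represented by one point, then a node of a finite net
    of [Y] at this point, then a node of a finite net of [K]. The preimages [b t] of balls of radius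
    1/(n+1) separate points, so by compactness their finite intersections form a base; lists over
    [T] are no more numerous than [J]. *)
Lemma separately_continuous_weight : weight_lt_csharp K X.
Proof.
have [d0 dE dC dT] := dm.
have [x0 _] := infinite_setN0 iX.
have cN := infinite_cell cX.2 iX.
have e_gt0 n : 0 < n.+1%:R^-1 :> R by rewrite invr_gt0 ltr0n.
(* This settles empty [K] and empty [Y], as [F_inj] leaves at most one point in [K] if [Y] is empty.
   Afterwards [k1] and [y1] can serve as defaults of [nth]. *)
have base0 : (forall k k' : K, k = k') -> weight_lt_csharp K X.
  move=> K1; apply: (@weight_lt_csharp_indexed X K nat unit (fun=> setT)) => //.
    by exists (fun=> 0%N) => -[] [].
  split=> [_ [_ _ <-]|U oU k Uk]; first exact: openT.
  by exists setT; split => //; [exists tt|move=> k' _; rewrite (K1 k' k)].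
have [[k1 _]|nK] := pselect (exists k : K, True); last first.
  by apply: base0 => k; case: nK; exists k.
have [[y1 _]|nY] := pselect (exists y : Y, True); last first.
  by apply: base0 => k k'; apply: F_inj => x y; case: nY; exists y.
have /choice[M MP] n := max_disjoint (@small_osc R X Y K Z d F n.+1%:R^-1).
have cM n : cell {U | M n U} [set: X].
  have [M1 M2 _] := MP n; exists sval; split => //.
  - by move=> [U MU] /=; have [] := M1 _ MU.
  - by move=> [U MU] [V MV] x /= Ux Vx; apply: eq_exist; exact: (M2 _ _ x).
have [J [cJ [nj nji] MJ]] := erdos_tarski cN cM.
(* [D] inverts the injections of the [M n] into [J]; an index that codes no member gets [setT]. *)
have /choice[D DP] : forall p : nat * J, exists U : set X,
    forall V, (exists2 MV : M p.1 V, projT1 (cid (MJ p.1)) (exist _ V MV) = p.2 & True) -> U = V.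
  move=> [n j] /=; have [[V [MV e _]]|nV] := pselect (exists V,
      exists2 MV : M n V, projT1 (cid (MJ n)) (exist _ V MV) = j & True); last first.
    by exists setT => V h; case: nV; exists V.
  by exists V => W [MW e' _]; move: e'; rewrite -e => /(projT2 (cid (MJ n))) [].
have DM n V : M n V -> exists j, D (n, j) = V.
  move=> MV; exists (projT1 (cid (MJ n)) (exist _ V MV)).
  by apply: DP; exists MV.
have /choice[c cP] : forall U : set X, exists x, U !=set0 -> U x.
  by move=> U; have [[x Ux]|nU] := pselect (U !=set0); [exists x|exists x0].
have /choice[netY netYP] : forall p : X * nat, exists s : seq Y, forall y, exists2 i,
    (i < size s)%N & forall k, d (F p.1 (nth y1 s i) k) (F p.1 y k) < p.2.+1%:R^-1.
  move=> [x m] /=; have [s sP] := compact_finite_cover cY.1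
    (fun y _ => Fy x y (e_gt0 m)).
  exists s => y; have [y' [y's _ h]] := sP y I; exists (index y' s); first by rewrite index_mem.
  by rewrite nth_index.
have /choice[netK netKP] : forall p : X * Y * nat, exists s : seq K, forall k, exists2 i,
    (i < size s)%N & d (F p.1.1 p.1.2 (nth k1 s i)) (F p.1.1 p.1.2 k) < p.2.+1%:R^-1.
  move=> [[x y] m] /=; have [s sP] := compact_finite_cover cK.1
    (fun k _ => Fk x y k (e_gt0 m)).
  exists s => k; have [k' [k's _ h]] := sP k I; exists (index k' s); first by rewrite index_mem.
  by rewrite nth_index.
pose T := (nat * J * nat * nat)%type.
pose px (t : T) := c (D t.1.1).
pose py (t : T) := nth y1 (netY (px t, t.1.1.1)) t.1.2.
pose pk (t : T) := nth k1 (netK (px t, py t, t.1.1.1)) t.2.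
pose b (t : T) := [set k | d (F (px t) (py t) (pk t)) (F (px t) (py t) k) < t.1.1.1.+1%:R^-1].
have ob t : open (b t).
  rewrite openE => k bk; rewrite /interior.
  have h : 0 < t.1.1.1.+1%:R^-1 - d (F (px t) (py t) (pk t)) (F (px t) (py t) k).
    by rewrite subr_gt0.
  apply: filterS (Fk (px t) (py t) k h) => k' h'; apply: le_lt_trans (dT _ _ _) _.
  by rewrite -ltrBrDl; exact: h'.
have sep k k' : k <> k' -> exists t, b t k /\ nbhs k' (~` b t).
  move=> kk'; have [x [y Fxy]] : exists x y, F x y k <> F x y k'.
    apply: contrapT => n; apply/kk'/F_inj => x y; apply: contrapT => h.
    by apply: n; exists x, y.
  pose dl := d (F x y k) (F x y k').
  have dl0 : 0 < dl by rewrite lt_neqAle d0 andbT; apply/eqP => /esym /dE.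
  (* Passing from [(x, y)] to [(c U, y')] costs three ninths, once at [k] and once at [k']; the
     other three pay for the passages from [k] to [k0], [k2] and [k']. *)
  have eta0 : 0 < dl / 9 by lra.
  have [n _ /(_ n (leqnn n)) nP] : \forall n \near \oo, n.+1%:R^-1 < dl / 9.
    exact: near_infty_natSinv_lt (PosNum eta0).
  have {}nP : n.+1%:R^-1 < dl / 9 := nP.
  have [M1 _ M3] := MP n.
  (* The member [U] of [M n] need not contain [x]. By Namioka's argument and maximality some [U]
     meets [O], where [F] at [y] is still close to its value at [x]. *)
  pose O := [set x' | forall k, d (F x y k) (F x' y k) < dl / 9]°.
  have oO : open O by exact: open_interior.
  have [|V [oV V0 VO sV]] := namioka cX cY dm Fx Fy (e_gt0 n) oO.
    by exists x; rewrite /O; exact: Fx.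
  have [U MU [x' [Vx' Ux']]] := M3 _ oV V0 sV.
  have [oU U0 sU] := M1 _ MU.
  have [j Dj] := DM _ _ MU.
  have Ucx := cP _ U0.
  have h1 k2 := sU _ _ y k2 Ux' Ucx.
  have h2 : forall k2, d (F x y k2) (F x' y k2) < dl / 9.
    by have /interior_subset := VO _ Vx'.
  have [i _ /= h3] := netYP (c U, n) y.
  pose y' := nth y1 (netY (c U, n)) i; rewrite -/y' in h3.
  have near2 k2 : d (F x y k2) (F (c U) y' k2) < 3 * (dl / 9).
    have := dT (F x y k2) (F x' y k2) (F (c U) y' k2).
    have := dT (F x' y k2) (F (c U) y k2) (F (c U) y' k2).
    move: (h2 k2) (lt_trans (h1 k2) nP) (lt_trans (h3 k2) nP).
    rewrite (dC (F (c U) y' k2)); lra.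
  have [i' _ /= h4] := netKP (c U, y', n) k.
  pose t : T := ((n, j), i, i').
  have pxE : px t = c U by rewrite /px /= Dj.
  have pyE : py t = y' by rewrite /py pxE.
  have pkE : pk t = nth k1 (netK (c U, y', n)) i' by rewrite /pk pxE pyE.
  exists t; split; first by rewrite /b /= pkE pxE pyE.
  apply: filterS (Fk (c U) y' k' eta0) => k2 h5; rewrite /b /= pkE pxE pyE => h6.
  set k0 := nth _ _ _ in h4 h6.
  have : dl < dl; last by rewrite ltxx.
  have := dT (F x y k) (F (c U) y' k) (F x y k').
  have := dT (F (c U) y' k) (F (c U) y' k0) (F x y k').
  have := dT (F (c U) y' k0) (F (c U) y' k2) (F x y k').
  have := dT (F (c U) y' k2) (F (c U) y' k') (F x y k').
  move: (near2 k) (near2 k') h5 (lt_trans h4 nP) (lt_trans h6 nP).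
  rewrite (dC (F x y k') (F (c U) _ _)) (dC (F _ _ k') (F _ _ k2)) (dC (F _ _ k0) (F _ _ k)).
  rewrite -/dl; lra.
pose bb (l : seq T) := foldr (fun t A => b t `&` A) setT l.
have bbP l k : bb l k <-> forall t, List.In t l -> b t k.
  elim: l => [//|t l [IH1 IH2]] /=; split=> [[bt /IH1 h] t' [<-//|/h//]|h].
  by split; [apply: h; left|apply: IH2 => t' t'l; apply: h; right].
apply: (@weight_lt_csharp_indexed X K J (seq T) bb) => //.
  have JJ := inj_le_square nji.
  have nJ : inj_le nat J by exists nj.
  have TJ : inj_le T J.
    do 3! [apply: (inj_le_trans _ JJ); apply: inj_le_prod => //].
    exact: inj_le_refl.
  apply: inj_le_trans (inj_le_seq nJ).
  by move: TJ => [g gi]; exists (map g); exact: inj_map.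
split=> [_ [l _ <-]|A oA k Ak].
  by elim: l => [|t l IH] /=; [exact: openT|exact: openI].
have /choice[t tP] : forall k', exists t, k <> k' -> b t k /\ nbhs k' (~` b t).
  move=> k'; have [kk'|kk'] := pselect (k = k'); last by have [t] := sep _ _ kk'; exists t.
  by exists ((0%N, nj 0%N), 0%N, 0%N).
have kA k' : (~` A) k' -> k <> k' by move=> nA e; apply: nA; rewrite -e.
have cA : compact (~` A) by apply: subclosed_compact cK.1 _ => //; exact: open_closedC.
(* Finitely many neighborhoods, each missing its [b (t k')], cover the complement of [A], so the
   intersection of these [b (t k')] lies in [A]. Only points outside [A] are kept in [l], as they
   differ from [k]. *)
have [s sP] := compact_finite_cover cA (fun k' h => (tP k' (kA k' h)).2).
pose l := map t [seq k' <- s | `[< ~ A k' >]].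
have lP t0 : List.In t0 l <-> exists k', [/\ k' \in s, ~ A k' & t k' = t0].
  rewrite /l; elim: (s) => [|k' s' [IH1 IH2]] /=.
    by split => // -[? []].
  case: ifPn => /asboolP h /=; split.
  - move=> [<-|/IH1 [k2 [h1 h2 h3]]]; first by exists k'; rewrite mem_head.
    by exists k2; rewrite inE h1 orbT.
  - move=> [k2 [+ h2 h3]]; rewrite inE => /orP[/eqP <-|k2s]; first by left.
    by right; apply: IH2; exists k2.
  - by move=> /IH1 [k2 [h1 h2 h3]]; exists k2; rewrite inE h1 orbT.
  - move=> [k2 [+ h2 h3]]; rewrite inE => /orP[/eqP e|k2s]; first by case: h; rewrite -e.
    by apply: IH2; exists k2.
exists (bb l); split; first by exists l.
  by apply/bbP => t0 /lP[k' [_ nA <-]]; exact: (tP k' (kA k' nA)).1.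
move=> k2 /bbP h; apply: contrapT => nA; have [k' [k's nA' nb]] := sP _ nA.
by apply: nb; apply: h; apply/lP; exists k'.
Qed.
End weight.

(** * Embeddings bound the weight *)

(** By regularity, separate continuity provides [O] and [V] whose closures, placed on the two arms
    of the cross, are mapped into [W]. The closure of the trace of the box on the cross stays within
    these two pieces. *)
Lemma cross_adm_nbhs (X Y Z : topologicalType) (s : X * Y -> Z) (W : set Z) (a : X) (b : Y) :
  compact_space X -> compact_space Y -> sep_cont s -> open W -> W (s (a, b)) ->
  exists O V A, [/\ nbhs a O, nbhs b V, @cross_adm X Y A,
    forall q, O q.1 -> V q.2 -> cross (a, b) q -> A q & s @` A `<=` W].
Proof.
move=> cX cY [s1 s2] oW Ws.
have nW : nbhs (s (a, b)) W by exact: open_nbhs_nbhs.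
have [ O [oO Oa clO]] := regular_nbhs cX (s2 b a _ nW).
have [V [oV Vb clV]] := regular_nbhs cY (s1 a b _ nW).
pose G := (O `*` V) `&` cross (a, b).
exists O, V, (closure G `&` cross (a, b)); split.
- exact: open_nbhs_nbhs.
- exact: open_nbhs_nbhs.
- exists (a, b), G; split => //; exists (O `*` V) => //.
  rewrite openE => -[x y] [Ox Vy]; exists (O, V) => //.
  by split; apply: open_nbhs_nbhs.
- by move=> q Oq Vq cq; split => //; apply: subset_closure.
- move=> _ [[x y] [clG [/= e|/= e]] <-]; rewrite e in clG *.
  + apply: clV => B yB.
    have [|[x' y'] [[[_ Vy'] _] [_ By']]] := clG (setT `*` B); last by exists y'.
    by exists (setT, B) => //; split => //; exact: filterT.
  + apply: clO => B xB.
    have [|[x' y'] [[[Ox' _] _] [Bx' _]]] := clG (B `*` setT); last by exists x'.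
    by exists (B, setT) => //; split => //; exact: filterT.
Qed.

Lemma cross_open_subbasic (X Y Z : topologicalType) (A : set (X * Y)) (W : set Z) :
  cross_adm A -> open W -> cross_open (cross_subbasic A W).
Proof.
move=> hA oW; split=> [s []//|s sAW]; exists [:: (A, W)]; split.
- by rewrite /= andbT; apply/asboolP.
- by move=> AW; rewrite inE => /eqP ->.
- by move=> t [_ /(_ (A, W) (mem_head _ _))].
Qed.

Section forward.
Variables (X Y Z K : topologicalType) (d : Z -> Z -> Rdefinitions.R).
Hypotheses (cX : compact_space X) (cY : compact_space Y) (cK : compact_space K).
Hypothesis dm : is_metric d.
Hypothesis d_open : forall U : set Z, open U <->
  (forall x, U x -> exists2 e : Rdefinitions.R, 0 < e & [set y | d x y < e] `<=` U).
Variable e : K -> X * Y -> Z.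
Hypothesis eS : forall k, sep_cont (e k).
Hypothesis e_cont : forall O, cross_open O -> open (e @^-1` O).

Let ball_open z r : open [set z' | d z z' < r].
Proof.
have [_ _ _ dT] := dm; apply/d_open => z' /= h; exists (r - d z z').
  by rewrite subr_gt0.
by move=> z2 /= h2; apply: le_lt_trans (dT _ z' _) _; rewrite -ltrBrDl.
Qed.

(** A cross-open neighborhood of [e k], made from an admissible set around [(a, b)] and a ball,
    pulls back to a neighborhood of [k]; so one box serves all nearby parameters. *)
Let near_param k a b r : 0 < r -> exists O V, [/\ nbhs a O, nbhs b V &
  \forall k' \near k, forall q, O q.1 -> V q.2 -> cross (a, b) q -> d (e k (a, b)) (e k' q) < r].
Proof.
have [_ dE _ _] := dm; move=> r0.
have Wk : d (e k (a, b)) (e k (a, b)) < r by rewrite (dE _ _).2.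
have [ O [V [A [aO bV hA OVA sA]]]] := cross_adm_nbhs cX cY (eS k) (ball_open _ r) Wk.
exists O, V; split => //.
have oN := e_cont (cross_open_subbasic hA (ball_open (e k (a, b)) r)).
apply: filterS (open_nbhs_nbhs (conj oN _)); last by split; [exact: eS|].
by move=> k' [_ h] q Oq Vq cq; apply: h; exists q => //; exact: OVA.
Qed.

(** Compactness of [K] leaves finitely many boxes to intersect; both values are compared with
    [e k0 (a, b)], whence the radius [r / 2]. *)
Let equicont a b r : 0 < r -> exists O V, [/\ nbhs a O, nbhs b V &
  forall k q, O q.1 -> V q.2 -> cross (a, b) q -> d (e k (a, b)) (e k q) < r].
Proof.
have [_ dE dC dT] := dm; move=> r0; have r20 : 0 < r / 2 by lra.
have /choice[ O OP] := fun k => near_param k a b r20.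
have /choice[V VP] := OP.
have [|s sP] := @compact_finite_cover _ _ (fun k => [set k' | forall q, O k q.1 -> V k q.2 ->
   cross (a, b) q -> d (e k (a, b)) (e k' q) < r / 2]) cK.1.
  by move=> k _; have [_ _] := VP k.
exists [set x | forall k, k \in s -> O k x], [set y | forall k, k \in s -> V k y].
split.
- by apply: near_seq => k _; have [] := VP k.
- by apply: near_seq => k _; have [] := VP k.
move=> k q Oq Vq cq; have [k0 [k0s _ h]] := sP k I.
have [/nbhs_singleton Oa /nbhs_singleton Vb _] := VP k0.
have h1 := h q (Oq _ k0s) (Vq _ k0s) cq.
have := h (a, b) Oa Vb (or_introl erefl).
have := dT (e k (a, b)) (e k0 (a, b)) (e k q).
by move: h1; rewrite (dC _ (e k0 (a, b))); lra.
Qed.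

Lemma near_sep_left a b r : 0 < r ->
  \forall x \near a, forall k, d (e k (a, b)) (e k (x, b)) < r.
Proof.
move=> /(equicont a b)[ O [V [aO bV h]]]; apply: filterS aO => x Ox k.
by apply: h => //=; [exact: nbhs_singleton|right].
Qed.

Lemma near_sep_right a b r : 0 < r ->
  \forall y \near b, forall k, d (e k (a, b)) (e k (a, y)) < r.
Proof.
move=> /(equicont a b)[ O [V [aO bV h]]]; apply: filterS bV => y Vy k.
by apply: h => //=; [exact: nbhs_singleton|left].
Qed.

Lemma near_sep_param a b k r : 0 < r ->
  \forall k' \near k, d (e k (a, b)) (e k' (a, b)) < r.
Proof.
move=> /(near_param k a b)[ O [V [aO bV]]]; apply: filterS => k' h.
by apply: h; [exact: nbhs_singleton|exact: nbhs_singleton|left].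
Qed.
End forward.

Lemma weight_of_embeds (X Y Z K : topologicalType) :
  compact_space X -> compact_space Y -> infinite_space X -> infinite_space Y ->
  metrizable Z -> compact_space K -> embeds_into_S X Y Z K ->
  weight_lt_csharp K X /\ weight_lt_csharp K Y.
Proof.
move=> cX cY iX iY [d [d0 dE dC dT dO]] cK [e [eS ei ec _]].
have dm : is_metric d by split.
have nX := near_sep_left cX cY cK dm dO eS ec.
have nY := near_sep_right cX cY cK dm dO eS ec.
have nK := near_sep_param cX cY dm dO eS ec.
have sep (k k' : K) : (forall x y, e k (x, y) = e k' (x, y)) -> k = k'.
  by move=> h; apply: ei; apply/funext => -[x y]; exact: h.
split.
  exact: (separately_continuous_weight (F := fun x y k => e k (x, y)) cX cY cK iX dm).
apply: (separately_continuous_weight (F := fun y x k => e k (x, y)) cY cX cK iY dm).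
- by move=> y x; exact: nY.
- by move=> y x; exact: nX.
- by move=> y x; exact: nK.
- by move=> k k' h; apply: sep => x y; exact: h.
Qed.

(** * Construction of embeddings *)

Lemma compact_urysohn (R : realType) (T : topologicalType) (C U : set T) :
    compact_space T -> closed C -> open U -> C `<=` U ->
  exists f : T -> R, [/\ continuous f, forall x, C x -> f x = 1 &
    forall x, ~ U x -> f x = 0].
Proof.
move=> [cT hT] cC oU CU.
have dis : ~` U `&` C = set0 by apply/disjoints_subset; rewrite setCS.
have [f [cf _ f0 f1]] := (uniform_separatorP (R := R) _ _).1
  ((normal_separatorP (R := R)).1 (compact_normal hT cT) _ _ (open_closedC oU) cC dis).
by exists f; split => // x hx; [apply: f1|apply: f0]; exists x.
Qed.

Lemma tube (T S Z : topologicalType) (H : T * S -> Z) (A : set S) (W : set Z) (t : T) :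
    continuous H -> compact A -> open W -> (forall s, A s -> W (H (t, s))) ->
  \forall t' \near t, forall s, A s -> W (H (t', s)).
Proof.
move=> cH /compact_near_coveringP cA oW AW.
apply: (cA T (nbhs t) (fun t' s => W (H (t', s)))) => s As.
have [[P Q] /= [tP sQ] PQ] := cH (t, s) _ (open_nbhs_nbhs (conj oW (AW _ As))).
by exists (Q, P) => // -[s' t'] /= [Qs Pt]; exact: (PQ (t', s')).
Qed.

(** Applied to a constant sequence, [erdos_tarski] merges the given family and a countably infinite
    one into a single infinite family at least as large as both. *)
Lemma cell_of_weight (X K : topologicalType) :
    hausdorff_space X -> infinite_space X -> weight_lt_csharp K X ->
  exists (B : set (set K)) (J : Type),
    [/\ is_base B, cell J [set: X], inj_le nat J & inj_le {b | B b} J].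
Proof.
move=> hX iX [U [B [[U1 U2] hB BU]]].
have cN := infinite_cell hX iX.
have cU : cell {u | U u} [set: X].
  exists sval; split => //.
  - by move=> [u Uu] /=; exact: U1.
  - move=> [u Uu] [v Uv] x /= ux vx; apply: eq_exist; apply: contrapT => uv.
    by have /seteqP[/(_ x) + _] := U2 _ _ Uu Uv uv; apply.
have [J [cJ nJ UJ]] := erdos_tarski cN (fun _ => cU).
exists B, J; split => //; apply: inj_le_trans (UJ 0%N).
move: BU => /card_leP[f].
exists (fun b : {b | B b} => let u := f (SigSub (mem_set (svalP b))) in
   exist _ (val u) (set_mem (valP u))).
move=> [b Bb] [b' Bb'] /= [] /val_inj e; apply: eq_exist.
by have [] := @inj _ _ _ f _ _ (in_setT _) (in_setT _) e.
Qed.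

(** As in Urysohn's metrization theorem, a pair of basic sets gets a separating function if the
    second contains the closure of the first, and zero otherwise. Regularity puts such a pair
    between a point and any open set around it. *)
Lemma base_functions (R : realType) (K : topologicalType) (B : set (set K)) :
    compact_space K -> is_base B ->
  exists f : {b | B b} * {b | B b} -> K -> R, (forall i, continuous (f i)) /\
    forall A k, open A -> A k -> exists i, f i k = 1 /\ forall k', ~ A k' -> f i k' = 0.
Proof.
move=> cK [Bo Bb].
have /choice[f fP] : forall i : {b | B b} * {b | B b}, exists f : K -> R, continuous f /\
    (closure (sval i.1) `<=` sval i.2 ->
     (forall k, sval i.1 k -> f k = 1) /\ (forall k, ~ sval i.2 k -> f k = 0)).
  move=> [[b hb] [b' hb']] /=.
  have [bb'|] := pselect (closure b `<=` b'); last first.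
    by exists (fun=> 0); split => // x; exact: cst_continuous.
  have [f [cf f1 f0]] := compact_urysohn R cK (@closed_closure _ b) (Bo _ hb') bb'.
  by exists f; split => // _; split => // k bk; apply: f1; exact: subset_closure.
exists f; split => [i|A k oA Ak]; first exact: (fP i).1.
have [b' [hb' b'k b'A]] := Bb _ oA _ Ak.
have [V [oV Vk Vb']] := regular_nbhs cK (open_nbhs_nbhs (conj (Bo _ hb') b'k)).
have [b [hb bk bV]] := Bb _ oV _ Vk.
exists (exist _ b hb, exist _ b' hb'); have [_ []] := fP (exist _ b hb, exist _ b' hb').
  by apply: subset_trans Vb'; exact: closureS.
by move=> f1 f0; split; [exact: f1|move=> k' nA; apply: f0 => /b'A].
Qed.

Lemma cell_bumps (R : realType) (X : topologicalType) (I : Type) :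
    compact_space X -> cell I [set: X] ->
  exists (U : I -> set X) (phi : I -> X -> R) (c : I -> X),
    [/\ forall i j x, U i x -> U j x -> i = j, forall i, continuous (phi i),
        forall i x, ~ U i x -> phi i x = 0 & forall i, U i (c i) /\ phi i (c i) = 1].
Proof.
move=> cX [U [U1 _ Ud]].
have /choice[c cP] := fun i => (U1 i).2.
have cl1 (x : X) : closed [set x].
  exact: accessible_closed_set1 (hausdorff_accessible cX.2) x.
have /choice[phi phiP] : forall i, exists f : X -> R, [/\ continuous f,
    forall x, [set c i] x -> f x = 1 & forall x, ~ U i x -> f x = 0].
  by move=> i; apply: compact_urysohn => //; [exact: (U1 i).1|move=> _ ->].
exists U, phi, c; split => //.
- by move=> i; have [] := phiP i.
- by move=> i; have [] := phiP i.
- by move=> i; split => //; have [_ + _] := phiP i; apply.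
Qed.

Section backward.
Variables (X Y Z K : topologicalType) (I : Type).
Local Notation R := Rdefinitions.R.
Variables (U : I -> set X) (phi : I -> X -> R) (c : I -> X).
Variables (V : I -> set Y) (psi : I -> Y -> R) (c' : I -> Y).
Variables (f : I -> K -> R) (g : R -> Z).
Hypotheses (cX : compact_space X) (cY : compact_space Y) (cK : compact_space K).
Hypotheses (Ud : forall i j x, U i x -> U j x -> i = j)
  (phi_cont : forall i, continuous (phi i))
  (phi0 : forall i x, ~ U i x -> phi i x = 0)
  (phi1 : forall i, U i (c i) /\ phi i (c i) = 1).
Hypotheses (Vd : forall i j y, V i y -> V j y -> i = j)
  (psi_cont : forall i, continuous (psi i))
  (psi0 : forall i y, ~ V i y -> psi i y = 0)
  (psi1 : forall i, V i (c' i) /\ psi i (c' i) = 1).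
Hypotheses (f_cont : forall i, continuous (f i))
  (f_sep : forall A k, open A -> A k ->
    exists i, f i k = 1 /\ forall k', ~ A k' -> f i k' = 0).
Hypothesis gE : embedding g.

(** For fixed [x] at most one term of the sum survives, and it is jointly continuous in [k] and [y];
    likewise for fixed [y]. Joint continuity is what the tube lemma takes. *)
Lemma bump_sum : exists h : X -> Y -> K -> R,
  [/\ forall i k, h (c i) (c' i) k = f i k,
      forall x, continuous (fun p : K * Y => h x p.2 p.1) &
      forall y, continuous (fun p : K * X => h p.2 y p.1)].
Proof.
have /choice[ix ixP] : forall x, exists o : option I,
    if o is Some i then U i x else forall i, ~ U i x.
  move=> x; have [[i Ui]|n] := pselect (exists i, U i x); first by exists (Some i).
  by exists None => i Ui; apply: n; exists i.
have /choice[iy iyP] : forall y, exists o : option I,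
    if o is Some i then V i y else forall i, ~ V i y.
  move=> y; have [[i Vi]|n] := pselect (exists i, V i y); first by exists (Some i).
  by exists None => i Vi; apply: n; exists i.
pose term i x y k := f i k * phi i x * psi i y.
pose h x y k := if ix x is Some i then term i x y k else 0.
(* The sum can be read off either coordinate: if [x] lies in [U i] and [y] in [V j] with i and j
   distinct, both terms vanish. *)
have hY x y k : h x y k = if iy y is Some j then term j x y k else 0.
  rewrite /h /term; case: (ix x) (ixP x) (iy y) (iyP y) => [i|] xi [j|] yj //.
  - have [->//|ij] := pselect (i = j).
    rewrite (psi0 (i := i)) 1?(phi0 (i := j)) ?mulr0 ?mul0r //.
      by move=> h1; apply: ij; exact: Ud h1.
    by move=> h1; apply: ij; exact: Vd yj.
  - by rewrite psi0 ?mulr0.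
  - by rewrite phi0 ?mulr0 ?mul0r.
exists h; split.
- move=> i k; rewrite /h /term; case: (ix _) (ixP (c i)) => [j h1|/(_ i)]; last first.
    by case: (phi1 i).
  by rewrite -(Ud (phi1 i).1 h1) (phi1 i).2 (psi1 i).2 !mulr1.
- move=> x; rewrite /h; case: (ix x) => [i|]; last by move=> p; exact: cst_continuous.
  move=> p; apply: (@continuousM _ (K * Y)%type (fun q => f i q.1 * phi i x) (fun q => psi i q.2) p).
    apply: (@continuousM _ (K * Y)%type (fun q => f i q.1) (fun=> phi i x) p).
      by apply: continuous_comp; [exact: cvg_fst|exact: f_cont].
    exact: cst_continuous.
  by apply: continuous_comp; [exact: cvg_snd|exact: psi_cont].
- move=> y; have -> : (fun p : K * X => h p.2 y p.1) =
      (fun p : K * X => if iy y is Some j then term j p.2 y p.1 else 0).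
    by apply/funext => p; exact: hY.
  case: (iy y) => [i|]; last by move=> p; exact: cst_continuous.
  move=> p; apply: (@continuousM _ (K * X)%type (fun q => f i q.1 * phi i q.2) (fun=> psi i y) p).
    apply: (@continuousM _ (K * X)%type (fun q => f i q.1) (fun q => phi i q.2) p).
      by apply: continuous_comp; [exact: cvg_fst|exact: f_cont].
    by apply: continuous_comp; [exact: cvg_snd|exact: phi_cont].
  exact: cst_continuous.
Qed.

(** An admissible set consists of a compact piece on each arm of a cross, so the tube lemma makes
    subbasic conditions open in [k]. Conversely, [e k] at [(c i, c' i)] is [g (f i k)], so the
    topology of [K] is recovered from evaluations at these points. *)
Lemma embeds_of_bumps : embeds_into_S X Y Z K.
Proof.
have [h [hc hY hX]] := bump_sum; have [gi gc go] := gE.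
pose e k p := g (h p.1 p.2 k).
have gY x : continuous (fun p : K * Y => g (h x p.2 p.1)).
  by move=> p; apply: continuous_comp (hY x p) (gc _).
have gX y : continuous (fun p : K * X => g (h p.2 y p.1)).
  by move=> p; apply: continuous_comp (hX y p) (gc _).
have pairl (S T : topologicalType) (s : S) : continuous (fun t : T => (s, t)).
  by move=> t; apply: cvg_pair => //; exact: cvg_cst.
have pairr (S T : topologicalType) (s : S) : continuous (fun t : T => (t, s)).
  by move=> t; apply: cvg_pair => //; exact: cvg_cst.
have eS k : sep_cont (e k).
  split=> [x y|y x].
    exact: (@continuous_comp _ _ _ (fun y => (k, y)) (fun p : K * Y => g (h x p.2 p.1)) y
      (pairl _ _ k y) (gY x _)).
  exact: (@continuous_comp _ _ _ (fun x => (k, x)) (fun p : K * X => g (h p.2 y p.1)) x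
    (pairl _ _ k x) (gX y _)).
have e_inj : injective e.
  move=> k k' ekk'; apply: contrapT => kk'.
  have oA : open (~` [set k']).
    by apply: closed_openC; exact: accessible_closed_set1 (hausdorff_accessible cK.2) k'.
  have [i [f1 f0]] := f_sep oA kk'.
  have /gi := congr1 (fun s => s (c i, c' i)) ekk'.
  by rewrite /= !hc f1 f0 => [/eqP|]; [rewrite oner_eq0|exact].
have near_sub k A W : cross_subbasic_pair (A, W) -> cross_subbasic A W (e k) ->
    \forall k' \near k, cross_subbasic A W (e k').
  move=> [/= [[a b] [G [_ AE]]] oW] [_ AW].
  have clY : compact [set y | closure G (a, y)].
    apply: subclosed_compact cY.1 _ => //.
    exact: (closed_comp (fun y _ => pairl _ _ a y) (@closed_closure _ G)).
  have clX : compact [set x | closure G (x, b)].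
    apply: subclosed_compact cX.1 _ => //.
    exact: (closed_comp (fun x _ => pairr _ _ b x) (@closed_closure _ G)).
  have nY : \forall k' \near k, forall y, closure G (a, y) -> W (e k' (a, y)).
    apply: (tube (gY a) clY oW) => y Gy; apply: AW; exists (a, y) => //.
    by rewrite AE; split => //; left.
  have nX : \forall k' \near k, forall x, closure G (x, b) -> W (e k' (x, b)).
    apply: (tube (gX b) clX oW) => x Gx; apply: AW; exists (x, b) => //.
    by rewrite AE; split => //; right.
  apply: filterS (filterI nY nX) => k' [hy hx]; split; first exact: eS.
  move=> _ [[x y] + <-]; rewrite AE => -[Gxy [/= xa|/= yb]].
    by rewrite xa in Gxy *; exact: hy.
  by rewrite yb in Gxy *; exact: hx.
exists e; split => //.
- move=> O [_ hO]; rewrite openE => k /hO [l [/allP lA lk lO]].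
  have near_l : \forall k' \near k, forall AW, AW \in l -> cross_subbasic AW.1 AW.2 (e k').
    apply: (near_seq (F := nbhs k) (P := fun AW k' => cross_subbasic AW.1 AW.2 (e k'))).
    by move=> [A W] AWl; apply: near_sub; [exact/asboolP/lA|exact: lk AWl].
  by apply: filterS near_l => k' hk'; apply: lO; split => //; exact: eS.
- move=> A oA.
  (* The threshold 1/2 lies between the value 1 of [f i] at a point of [A] and its value 0 off [A];
     [B] transports it to [Z]. *)
  have [B oB gB] := go _ (@open_gt R (1 / 2)).
  pose good i := forall k', ~ A k' -> f i k' = 0.
  pose O := [set t : X * Y -> Z | sep_cont t /\ exists2 i, good i & B (t (c i, c' i))].
  exists O.
    split=> [t []//|t [tS [i gi' Bt]]].
    have [P [Q [D [aP bQ hD PQD tD]]]] := cross_adm_nbhs cX cY tS oB Bt.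
    exists [:: (D, B)]; split.
    - by rewrite /= andbT; apply/asboolP.
    - by move=> DB; rewrite inE => /eqP ->.
    - move=> t' [t'S /(_ (D, B) (mem_head _ _)) [_ t'D]]; split => //; exists i => //.
      apply: t'D; exists (c i, c' i) => //; apply: PQD; last by left.
        exact: nbhs_singleton aP.
      exact: nbhs_singleton bQ.
  apply/seteqP; split.
  - move=> _ [k Ak <-]; split; first by exists k.
    split; first exact: eS.
    have [i [f1 f0]] := f_sep oA Ak; exists i => //.
    have : (g @` [set: R] `&` B) (g (f i k)).
      by rewrite -gB; exists (f i k) => //=; rewrite f1; lra.
    by rewrite /e /= hc => -[].
  - move=> _ [[k _ <-] [_ [i gi' Bt]]]; exists k => //.
    apply: contrapT => nA; have : (g @` [set: R] `&` B) (g (f i k)).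
      by split; [exists (f i k)|move: Bt; rewrite /e /= hc].
    by rewrite -gB => -[r /= r12 /gi rf]; move: r12; rewrite rf (gi' _ nA); lra.
Qed.
End backward.

Theorem theorem7p1 (X Y Z K : topologicalType) :
  compact_space X -> compact_space Y -> infinite_space X -> infinite_space Y ->
  metrizable Z -> contains_real_line Z ->
  compact_space K ->
  (embeds_into_S X Y Z K <-> (weight_lt_csharp K X /\ weight_lt_csharp K Y)).
Proof.
move=> cX cY iX iY mZ [g gE] cK; split; first exact: weight_of_embeds.
move=> [/(cell_of_weight cX.2 iX)[B1 [J1 [hB1 cJ1 nJ1 BJ1]]]].
move=> /(cell_of_weight cY.2 iY)[B2 [J2 [hB2 cJ2 nJ2 BJ2]]].
(* The hypotheses on [X] and [Y] provide two bases of [K]; the one with fewer members is bounded by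
   both cellular families. *)
have [B [hB [BX BY]]] : exists B : set (set K),
    is_base B /\ inj_le {b | B b} J1 /\ inj_le {b | B b} J2.
  have [B12|B21] := inj_le_total {b | B1 b} {b | B2 b}.
    by exists B1; split => //; split => //; exact: inj_le_trans B12 BJ2.
  by exists B2; split => //; split => //; exact: inj_le_trans B21 BJ1.
(* The functions on [K] are indexed by pairs of basic sets, and the infinite [J] absorbs the
   square. *)
have square (J : Type) : inj_le nat J -> inj_le {b | B b} J ->
    inj_le ({b | B b} * {b | B b}) J.
  by move=> [n ni] BJ; apply: inj_le_trans (inj_le_square ni); exact: inj_le_prod.
have [f [fc fs]] := base_functions Rdefinitions.R cK hB.
have [U [phi [c [U1 U2 U3 U4]]]] :=
  cell_bumps Rdefinitions.R cX (cell_inj (square _ nJ1 BX) cJ1).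
have [V [psi [c' [V1 V2 V3 V4]]]] :=
  cell_bumps Rdefinitions.R cY (cell_inj (square _ nJ2 BY) cJ2).
exact: (embeds_of_bumps cX cY cK U1 U2 U3 U4 V1 V2 V3 V4 fc fs gE).
Qed.
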